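(* Let $T$ be a countably infinite tree and $S$ a tree with $S\approx T$. If there is an embedding $\psi\colon S\to T$ such that some connected component of $T-\psi(S)$ contains a comb, then $m(T)$ is infinite.
   Context: An embedding is an injective graph homomorphism; for trees we write $S\approx T$ if each embeds into the other. $T-\psi(S)$ is the graph obtained from $T$ by deleting the vertices of $\psi(S)$. A comb is a tree consisting of a ray (one-way infinite path) together with infinitely many pairwise disjoint finite paths of positive length, each meeting the ray in exactly one vertex, an endpoint of the path. The twin number $m(T)$ is the cardinality of the set of isomorphism classes of trees $T'$ with $T'\approx T$. *)

(* Defs.v *)
From mathcomp Require Import all_boot.
From mathcomp Require Import all_classical.
Set Implicit Arguments.
Unset Strict Implicit.
Unset Printing Implicit Defensive.
Local Open Scope classical_set_scope.

(* The decidable edge relation and the choiceType structure are no restriction: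
   classically, every type carries a choiceType structure and every
   proposition is equivalent to a boolean. *)
Record graph := Graph {
  vertex :> choiceType;
  edge : rel vertex;
  edge_sym : symmetric edge;
  edge_irr : irreflexive edge
}.

Definition reachable (G : graph) (x y : G) : Prop :=
  exists p : seq G, path (@edge G) x p /\ last x p = y.

(* An edge traversed back and forth is a [ucycle] of size 2, hence the bound. *)
Definition acyclic (G : graph) : Prop :=
  forall c : seq G, ucycle (@edge G) c -> (size c < 3)%N.

Definition is_tree (G : graph) : Prop :=
  [/\ inhabited G, forall x y : G, reachable x y & acyclic G].

Definition embedding (G H : graph) (f : G -> H) : Prop :=
  injective f /\ {homo f : x y / edge x y}.

Definition embeds (G H : graph) : Prop := exists f : G -> H, embedding f.

Definition twins (G H : graph) : Prop := embeds G H /\ embeds H G.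

Definition isomorphic (G H : graph) : Prop :=
  exists f : G -> H, bijective f /\ {mono f : x y / edge x y}.

Definition induced_edge (G : graph) (A : set G) : rel A :=
  fun x y => edge (val x) (val y).

Lemma induced_edge_sym (G : graph) (A : set G) : symmetric (@induced_edge G A).
Proof. by move=> x y; exact: edge_sym. Qed.

Lemma induced_edge_irr (G : graph) (A : set G) :
  irreflexive (@induced_edge G A).
Proof. by move=> x; exact: edge_irr. Qed.

Definition induced (G : graph) (A : set G) : graph :=
  Graph (@induced_edge_sym G A) (@induced_edge_irr G A).

Definition delete (G : graph) (A : set G) : graph := induced (~` A).

Definition is_component (G : graph) (K : set G) : Prop :=
  exists x : G, K = [set y | reachable x y].

Definition is_ray (G : graph) (r : nat -> G) : Prop :=
  injective r /\ forall n, edge (r n) (r n.+1).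

(* The pair [(x, q)] stands for the path with vertex sequence [x :: q],
   oriented so that [x] is its endpoint on the ray. *)
Definition tooth_vertices (G : graph) (t : G * seq G) : seq G := t.1 :: t.2.

Definition is_tooth (G : graph) (r : nat -> G) (t : G * seq G) : Prop :=
  [/\ path (@edge G) t.1 t.2, uniq (tooth_vertices t), t.2 != [::],
      range r t.1 & forall y, y \in t.2 -> ~ range r y].

Definition comb_arc (G : graph) (r : nat -> G) (P : set (G * seq G))
    (x y : G) : Prop :=
  (exists n, x = r n /\ y = r n.+1) \/
  (exists2 t, P t & infix [:: x; y] (tooth_vertices t)).

Definition is_comb (C : graph) : Prop :=
  is_tree C /\
  exists (r : nat -> C) (P : set (C * seq C)),
    [/\ is_ray r,
        infinite_set P,
        forall t, P t -> is_tooth r t,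
        trivIset P (fun t => [set y | y \in tooth_vertices t]) &
        (forall x : C, range r x \/ exists2 t, P t & x \in tooth_vertices t) /\
        (forall x y : C, edge x y -> comb_arc r P x y \/ comb_arc r P y x)].

(* Being isomorphic to a (not necessarily induced) subgraph of [G] is the same
   as embedding into [G]. *)
Definition contains_comb (G : graph) : Prop :=
  exists C : graph, is_comb C /\ embeds C G.

Definition iso_class (G : graph) : graph -> Prop := fun H => isomorphic G H.

(* The twin number of [T] is the cardinality of this collection of classes. *)
Definition twin_classes (T : graph) : (graph -> Prop) -> Prop :=
  fun c => exists T' : graph, [/\ is_tree T', twins T' T & c = iso_class T'].

(* Substitute for [infinite_set], whose universe level is too small for it to
   apply to collections of classes of graphs. *)
Definition infinite_collection (X : Type) (A : X -> Prop) : Prop :=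
  ~ exists (n : nat) (f : 'I_n -> X), forall x, A x -> exists i, f i = x.

Definition infinite_twin_number (T : graph) : Prop :=
  infinite_collection (twin_classes T).

(* Main.v *)
(* Let [F] be the image of [S]. Far enough along the ray [r] of the comb, [F]
   lies on one side of the edge from [r 0] to [r 1] (after renumbering). On the
   other side, delete everything but the ray and the tips of the teeth indexed
   by a set [D]: this leaves a tree between [F] and [T], hence a twin of [T].
   In any graph an initial edge of a bare comb with single-leaf teeth determines
   the whole comb, and so the set [D]. A countable graph therefore carries only
   countably many sets [D], and so do finitely many isomorphism classes of twins
   together, whereas uncountably many [D] are available. *)

Require Import Defs.
From mathcomp Require Import all_boot.
From mathcomp Require Import all_classical.
Local Open Scope classical_set_scope.
Local Open Scope card_scope.

Set Implicit Arguments.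
Unset Strict Implicit.
Unset Printing Implicit Defensive.

(* Cantor's theorem in a form that avoids cardinal arithmetic: [R] is a partial
   map from [K] to sets, and the diagonal set it misses is made of codes. *)
Lemma cantor_diagonal (K X : Type) (c : K -> X) (R : K -> set X -> Prop) :
  injective c -> (forall k D E, R k D -> R k E -> D = E) ->
  exists2 D, D `<=` range c & forall k, ~ R k D.
Proof.
move=> c_inj R_fun.
exists [set x | exists k E, [/\ x = c k, R k E & ~ E x]].
  by move=> _ [k [E [-> _ _]]]; exists k.
set D := [set _ | _] => k RkD.
have DckN : ~ D (c k).
  move=> Dck; have [j [E [/c_inj kj RjE]]] := Dck.
  by subst j; rewrite (R_fun _ _ _ RjE RkD).
by apply: (DckN); exists k, D.
Qed.

(** * Reachability, and paths that avoid a vertex *)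

Lemma reachable_edge (G : graph) (x y z : G) :
  edge x y -> reachable y z -> reachable x z.
Proof. by move=> exy [p [yp pz]]; exists (y :: p); rewrite /= exy. Qed.

Lemma reachable_trans (G : graph) (x y z : G) :
  reachable x y -> reachable y z -> reachable x z.
Proof.
move=> [p [xp <-]] [q [pq <-]]; exists (p ++ q).
by rewrite cat_path last_cat xp.
Qed.

Lemma reachable_sym (G : graph) (x y : G) : reachable x y -> reachable y x.
Proof.
move=> [p [xp <-]]; exists (rev (belast x p)); split.
  by rewrite rev_path (eq_path (e' := @edge G)) // => a b; rewrite edge_sym.
by case: p {xp} => //= a p; rewrite rev_cons last_rcons.
Qed.

Lemma isomorphic_refl (G : graph) : isomorphic G G.
Proof. by exists id; split=> //; exists id. Qed.

(** This says that [a] and [b] lie in one component of [G] minus [x]; using paths of [G] itself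
    avoids the subtype behind [delete]. *)
Definition avoiding (G : graph) (x a b : G) : Prop :=
  exists p : seq G, [/\ path (@edge G) a p, last a p = b & x \notin a :: p].

Lemma avoiding_refl (G : graph) (x a : G) : a <> x -> avoiding x a a.
Proof.
by move=> ax; exists [::]; split=> //; rewrite inE; apply/eqP/nesym.
Qed.

Lemma avoiding_trans (G : graph) (x a b c : G) :
  avoiding x a b -> avoiding x b c -> avoiding x a c.
Proof.
move=> [p [ap <- xp]] [q [pq <- xq]]; exists (p ++ q).
rewrite cat_path last_cat ap pq -cat_cons mem_cat negb_or xp; split=> //=.
by apply: contra xq; rewrite inE => ->; rewrite orbT.
Qed.

Lemma avoiding_sym (G : graph) (x a b : G) : avoiding x a b -> avoiding x b a.
Proof.
move=> [p [ap <- xp]]; exists (rev (belast a p)); split.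
- by rewrite rev_path (eq_path (e' := @edge G)) // => u v; rewrite edge_sym.
- by case: p {ap xp} => //= u p; rewrite rev_cons last_rcons.
- by move: xp; rewrite lastI -rev_rcons mem_rev.
Qed.

Lemma avoiding_edge (G : graph) (x a b : G) :
  a <> x -> b <> x -> edge a b -> avoiding x a b.
Proof.
move=> /nesym/eqP ax /nesym/eqP bx eab; exists [:: b].
by rewrite /= eab !inE negb_or ax bx.
Qed.

Lemma avoiding_ends (G : graph) (x a b : G) :
  avoiding x a b -> a <> x /\ b <> x.
Proof.
move=> [p [_ <- xp]]; split=> xE; move: xp.
  by rewrite xE mem_head.
by rewrite -xE mem_last.
Qed.

(* Otherwise closing up the path from [a] to [b] at [x] gives a cycle. *)
Lemma acyclic_neighbor_eq (G : graph) (x a b : G) : acyclic G ->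
  edge x a -> edge x b -> avoiding x a b -> a = b.
Proof.
move=> acG xa xb [p [ap pb xp]]; subst b.
case/shortenP: ap xb => p' ap' up' sp' xb.
suff /acG : ucycle (@edge G) [:: x, a & p'] by case: p' {ap' up' sp' xb}.
apply/andP; split; first by rewrite /= xa rcons_path ap' edge_sym xb.
rewrite cons_uniq up' andbT.
by apply: contra xp; rewrite !inE => /orP[->//|/sp' ->]; rewrite orbT.
Qed.

(** * Rays in acyclic graphs *)

Lemma avoiding_ray_le (G : graph) (r : nat -> G) (x : G) (i j : nat) :
  is_ray r -> (i <= j)%N -> (forall n, (i <= n <= j)%N -> r n <> x) ->
  avoiding x (r i) (r j).
Proof.
move=> [_ er]; elim: j => [|j IH] ij rx.
  by move: ij rx; rewrite leqn0 => /eqP -> rx; apply/avoiding_refl/rx.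
have [ji|{}ij] := ltnP j i.
  have -> : i = j.+1 by apply/eqP; rewrite eqn_leq ij.
  by apply: avoiding_refl; apply: rx; rewrite ij leqnn.
apply: avoiding_trans (IH ij _) _ => [n /andP[lin nj]|].
  by apply: rx; rewrite lin leqW.
by apply: avoiding_edge => //; apply: rx; rewrite ?ij ?leqnn ?leqnSn ?leqW.
Qed.

Lemma avoiding_ray (G : graph) (r : nat -> G) (x : G) (i j : nat) :
  is_ray r -> (forall n, r n <> x) -> avoiding x (r i) (r j).
Proof.
move=> rr rx; case/orP: (leq_total i j) => ij; last apply: avoiding_sym;
  by apply: avoiding_ray_le.
Qed.

(** For [i < j] the ray joins the neighbors [r i.+1] and [r j] of [r i] without returning to [r i],
    so acyclicity makes them equal. *)
Lemma acyclic_ray_chordless (G : graph) (r : nat -> G) (i j : nat) :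
  acyclic G -> is_ray r -> edge (r i) (r j) -> i = j.+1 \/ j = i.+1.
Proof.
move=> acG rr; wlog ij : i j / (i < j)%N => [H|] eij.
  case: (ltngtP i j) => ij; first exact: H.
    by case: (H j i); rewrite 1?edge_sym //; [right|left].
  by rewrite ij edge_irr in eij.
right; apply: esym; apply: rr.1.
apply: (acyclic_neighbor_eq acG (rr.2 i) eij).
apply: avoiding_ray_le => // n /andP[lin _] /rr.1 nE.
by rewrite nE ltnn in lin.
Qed.

(** * Bare combs and their initial edges *)

(* From [r 1] on, [r] has no side branches but single leaves, and [D] records
   (with a shift by one) where these leaves sit. *)
Definition comb_end (G : graph) (u v : G) (D : set nat) : Prop :=
  exists r : nat -> G, [/\ r 0 = u, r 1 = v, is_ray r,
    forall n y, edge (r n.+1) y ->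
      [\/ y = r n, y = r n.+2 | forall z, edge y z -> z = r n.+1] &
    forall n, D n <-> exists y, [/\ edge (r n.+1) y, y <> r n & y <> r n.+2]].

(** Once the two rays agree up to [n.+1], the vertex [s n.+2] differs from [r n] by injectivity and
    is no leaf, having the further neighbor [s n.+3]; only [r n.+2] is left for it. *)
Lemma comb_end_inj (G : graph) (u v : G) (D E : set nat) :
  comb_end u v D -> comb_end u v E -> D = E.
Proof.
move=> [r [r0 r1 [ri re] rleaf rD]] [s [s0 s1 [si se] sleaf sE]].
have rs n : r n = s n /\ r n.+1 = s n.+1.
  elim: n => [|n [IH0 IH1]]; first by rewrite r0 r1.
  split=> //; have := rleaf n (s n.+2); rewrite IH1 => /(_ (se _)) [].
  - by rewrite IH0 => /si /eqP; rewrite gtn_eqF.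
  - by [].
  - by move=> /(_ _ (se _)) /si /eqP; rewrite gtn_eqF.
apply/seteqP; split=> n.
  by move=> /rD H; apply/sE; rewrite -!(rs _).1.
by move=> /sE H; apply/rD; rewrite !(rs _).1.
Qed.

Lemma isomorphic_comb_end (G H : graph) (u v : H) (D : set nat) :
  isomorphic G H -> comb_end u v D -> exists u' v' : G, comb_end u' v' D.
Proof.
move=> [h [[g hK gK] he]] [r [r0 r1 [ri re] rleaf rD]].
have ge x y : edge (g x) (g y) = edge x y by rewrite -he !gK.
have gE x y : x = g y <-> h x = y by split=> [->|<-].
exists (g u), (g v), (g \o r); split=> /=; rewrite ?r0 ?r1 //.
- by split=> [m n /= /(can_inj gK) /ri //|n /=]; rewrite ge.
- move=> n y; rewrite -he gK => /rleaf [yE|yE|yE].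
  + by apply: Or31; apply/gE.
  + by apply: Or32; apply/gE.
  + by apply: Or33 => z; rewrite -he => /yE zE; apply/gE.
- move=> n; split.
    move=> /rD [y [e1 y1 y2]]; exists (g y); rewrite ge.
    by split=> // /(can_inj gK).
  move=> [y [e1 y1 y2]]; apply/rD; exists (h y).
  by rewrite -he gK in e1; split=> // /gE.
Qed.

(** * Pruned subtrees *)

Section Pruning.

Context (T : graph) (r t : nat -> T).
Hypotheses (Ttree : is_tree T) (rray : is_ray r).
Hypothesis (toff : forall i j, t i <> r j).

(** In the tree [T], this is the side of the edge from [r 0] to [r 1] that contains [r 1]. *)
Definition branch : set T := [set y | avoiding (r 0) (r 1) y].

(** Only the branch is thinned out. The tip [t n] is meant to hang at [r n.+1], which matches the
    shift in [comb_end]. *)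
Definition pruned (D : set nat) : set T :=
  ~` branch `|` range r `|` t @` D.

Let Tac : acyclic T. Proof. by case: Ttree. Qed.

Let rpos n : r n.+1 <> r 0. Proof. by move=> /rray.1. Qed.

Lemma branch_ray n : branch (r n.+1).
Proof. by apply: avoiding_ray_le => // -[|m] // _. Qed.

Lemma branch_edge x y : branch x -> edge x y -> y <> r 0 -> branch y.
Proof.
move=> bx exy y0; apply: avoiding_trans (bx) _; apply: avoiding_edge => //.
by case: (avoiding_ends bx).
Qed.

Lemma pruned_ray D n : pruned D (r n).
Proof. by left; right; exists n. Qed.

(** Everything reaches [r 0]: the ray backwards, a tip through its ray vertex, and a vertex outside
    the branch along a path of [T], which cannot enter the branch before meeting [r 0]. *)
Lemma pruned_connected D (x y : induced (pruned D)) :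
  (forall n, D n -> edge (r n.+1) (t n)) -> reachable x y.
Proof.
move=> eD; pose o n : induced (pruned D) := exist _ (r n) (mem_set (pruned_ray D n)).
suff to0 z : reachable z (o 0).
  by apply: reachable_trans (to0 x) _; apply/reachable_sym/to0.
have ray0 n : reachable (o n) (o 0).
  elim: n => [|n IH]; first by exists [::].
  by apply: reachable_edge IH; rewrite /= /induced_edge /= edge_sym rray.2.
have [zb|/negP zb] := boolP `[< branch (val z) >].
  case: z zb => z zP /asboolP /= zb.
  case: (set_mem zP) => [[//|[n _ zE]]|[n Dn zE]]; subst z.
    rewrite (_ : exist _ _ _ = o n) //; exact: val_inj.
  apply: reachable_edge (ray0 n.+1).
  by rewrite /= /induced_edge /= edge_sym eD.
have [p [zp p0]] : reachable (val z) (r 0) by case: Ttree.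
elim: p z zp p0 zb => [|a p IH] z /= zp p0 zb.
  have -> : z = o 0 by apply: val_inj.
  exact: ray0.
have [z0|/eqP z0] := eqVneq (val z) (r 0).
  have -> : z = o 0 by apply: val_inj.
  exact: ray0.
case/andP: zp => eza ap.
have ab : ~ branch a.
  move=> ab; apply: zb; apply/asboolP; apply: branch_edge ab _ z0.
  by rewrite edge_sym.
have aP : pruned D a by left; left.
apply: (@reachable_edge _ z (exist _ a (mem_set aP))) => //.
by apply: IH => //; apply/negP/asboolPn.
Qed.

Lemma pruned_is_tree D :
  (forall n, D n -> edge (r n.+1) (t n)) -> is_tree (induced (pruned D)).
Proof.
move=> eD; split.
- exact: inhabits (exist _ (r 0) (mem_set (pruned_ray D 0))).
- by move=> x y; exact: pruned_connected.
- move=> c /andP[cyc unc]; rewrite -(size_map val); apply: Tac.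
  apply/andP; split; last by rewrite map_inj_uniq //; exact: val_inj.
  by case: c cyc {unc} => //= x p; rewrite -map_rcons path_map.
Qed.

(** Inside the branch only the ray and the tips remain, and acyclicity leaves each tip no neighbor
    but its ray vertex. *)
Lemma pruned_comb_end D (eD : forall n, D n -> edge (r n.+1) (t n)) :
  exists u v : induced (pruned D), comb_end u v D.
Proof.
pose o n : induced (pruned D) := exist _ (r n) (mem_set (pruned_ray D n)).
have neighbor (x y : induced (pruned D)) :
    branch (val x) -> edge x y ->
    (exists n, y = o n) \/ (exists2 n, D n & val y = t n).
  move=> bx exy; have [y0|/eqP y0] := eqVneq (val y) (r 0).
    by left; exists 0; apply: val_inj.
  have by' : branch (val y) by apply: branch_edge bx exy y0.
  case: (set_mem (valP y)) => [[//|[n _ yE]]|[n Dn yE]].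
    by left; exists n; apply: val_inj.
  by right; exists n.
have tooth_ray n m : D n -> edge (t n) (r m) -> m = n.+1.
  move=> Dn enm; apply: rray.1; apply: (acyclic_neighbor_eq Tac enm).
    by rewrite edge_sym eD.
  by apply: avoiding_ray => // k /esym; apply: toff.
(* The way from [t m] to [r m.+1] and on along the ray to [r n.+1] avoids [t n], so [t m] would
   equal [r n.+1]. *)
have tooth_tooth n m : D n -> D m -> ~ edge (t n) (t m).
  move=> Dn Dm enm; have tr k : r k <> t n by move=> /esym; apply: toff.
  have tt : t m <> t n by move=> tE; rewrite tE edge_irr in enm.
  apply: (@toff m n.+1).
  apply: (acyclic_neighbor_eq Tac enm); first by rewrite edge_sym eD.
  apply: avoiding_trans (avoiding_ray m.+1 n.+1 rray tr).
  by apply: avoiding_edge => //; rewrite edge_sym eD.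
exists (o 0), (o 1), o; split=> //.
- by split=> [m n /(congr1 val) /= /rray.1 //|n]; exact: rray.2.
- move=> n y eny; have [[m yE]|[m Dm yE]] := neighbor (o n.+1) y (branch_ray n) eny.
    subst y; case: (acyclic_ray_chordless Tac rray eny) => [[<-]|->].
      exact: Or31.
    exact: Or32.
  have mn : n = m.
    apply: succn_inj; apply: tooth_ray Dm _.
    by rewrite -yE edge_sym; exact: eny.
  subst m; apply: Or33 => z eyz.
  have bz : branch (val y).
    by rewrite yE; apply: branch_edge (branch_ray n) (eD _ Dm) _; exact: toff.
  have [[k zE]|[k Dk zE]] := neighbor _ _ bz eyz.
    subst z; apply: val_inj => /=; congr r.
    by apply: (tooth_ray _ _ Dm); rewrite -yE.
  by case: (tooth_tooth _ _ Dm Dk); rewrite -yE -zE.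
- move=> n; split=> [Dn|[y [eny yn yn2]]].
    have tP : pruned D (t n) by right; exists n.
    exists (exist _ (t n) (mem_set tP)); split; first exact: eD.
      by move=> /(congr1 val) /=; exact: toff.
    by move=> /(congr1 val) /=; exact: toff.
  have [[m yE]|[m Dm yE]] := neighbor (o n.+1) y (branch_ray n) eny.
    subst y; case: (acyclic_ray_chordless Tac rray eny) => [[mE]|mE].
      by case: yn; rewrite mE.
    by case: yn2; rewrite mE.
  suff [->//] : n.+1 = m.+1.
  by apply: tooth_ray Dm _; rewrite -yE edge_sym; exact: eny.
Qed.

End Pruning.

(** * Position of the image of [S], and teeth of a comb *)

(** Pigeonhole. The index is a successor so that the vertex found has a predecessor on the ray. *)
Lemma ray_leaves_seq (T : graph) (r : nat -> T) (p : seq T) :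
  is_ray r -> exists k, r k.+1 \notin p.
Proof.
move=> [ri _]; apply: contrapT => /forallNP rp.
pose s := [seq r i.+1 | i <- iota 0 (size p).+1].
have us : uniq s by rewrite map_inj_uniq ?iota_uniq // => i j /ri [].
have /(uniq_leq_size us) : {subset s <= p}.
  by move=> _ /mapP[i _ ->]; apply/negPn/negP/rp.
by rewrite size_map size_iota ltnn.
Qed.

Lemma range_off_branch (S T : graph) (psi : S -> T) (r : nat -> T) :
  is_tree S -> is_tree T -> embedding psi -> is_ray r ->
  (forall s n, psi s <> r n) ->
  exists k, forall s, ~ branch (fun n => r (k + n)) (psi s).
Proof.
move=> [[s0] Sconn _] [_ Tconn Tac] [_ psi_edge] rray psir.
have [p [sp p0]] := Tconn (psi s0) (r 0).
(* If [psi s] were beyond [r k.+1], one could get from [r k.+2] to [r k] through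
   [psi s], [psi s0] and [r 0] while avoiding [r k.+1]. *)
have [k kp] := ray_leaves_seq (psi s0 :: p) rray.
exists k.+1 => s; rewrite /branch /= addn0 addn1 => bs.
have [q [sq qs0]] := Sconn s s0.
have bs0 : avoiding (r k.+1) (psi s) (psi s0).
  exists (map psi q); split; last 1 first.
  - by rewrite -map_cons; apply/mapP => -[x _ /esym]; apply: psir.
  - by rewrite path_map; apply: sub_path sq.
  - by rewrite last_map qs0.
have b0 : avoiding (r k.+1) (psi s0) (r 0) by exists p.
have bk : avoiding (r k.+1) (r 0) (r k).
  apply: avoiding_ray_le => // n nk /rray.1 nE.
  by rewrite nE ltnn in nk.
have /rray.1 /eqP : r k.+2 = r k; last by rewrite gtn_eqF.
apply: (acyclic_neighbor_eq Tac (rray.2 k.+1)); first by rewrite edge_sym rray.2.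
apply: avoiding_trans bs _; apply: avoiding_trans bs0 _.
exact: avoiding_trans b0 bk.
Qed.

(** Of each tooth only the first vertex after the ray is needed; it serves as the tip. *)
Lemma comb_teeth (C : graph) : is_comb C -> exists (r t : nat -> C) (A : set nat),
  [/\ is_ray r, infinite_set A, forall n, A n -> edge (r n) (t n) &
      forall i j, t i <> r j].
Proof.
move=> [_ [r [P [rray Pinf Ptooth Ptriv _]]]].
have toothP u : P u -> exists n y, [/\ u.1 = r n, edge (r n) y & ~ range r y].
  move=> /Ptooth; case: u => x [|y q] [] //= /andP[exy _] _ _ [n _ rn] off.
  by exists n, y; rewrite rn; split=> //; apply: off; exact: mem_head.
pose A := [set n | exists2 u, P u & u.1 = r n].
(* [y0] is the default value of [t] outside [A], so that [t] misses the ray at every index. *)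
have [_ [y0 [_ _ y0r]]] : exists n y, [/\ A n, edge (r n) y & ~ range r y].
  have /infinite_setN0 [u /[dup] Pu /toothP [n [y [un ey yr]]]] := Pinf.
  by exists n, y; split=> //; exists u.
have /choice [t tP] n : exists y, (A n -> edge (r n) y) /\ ~ range r y.
  have [[u Pu un]|An] := pselect (A n); last by exists y0.
  have [m [y [um ey yr]]] := toothP _ Pu.
  by exists y; split=> // _; rewrite -un um.
exists r, t, A; split=> //.
- apply: contra_not Pinf => Afin.
  (* Teeth attached at the same ray vertex share it, hence coincide: [fst] is injective on [P]. *)
  rewrite -(eq_finite_set (inj_card_eq (f := fst) _)).
    apply: sub_finite_set (finite_image r Afin) => _ [u Pu <-].
    have [n [_ [un _ _]]] := toothP _ Pu.
    by exists n => //; exists u.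
  move=> u v /set_mem Pu /set_mem Pv uv; apply: (Ptriv _ _ Pu Pv).
  exists u.1; split; first exact: mem_head.
  by rewrite uv; exact: mem_head.
- by move=> n; case: (tP n).
- by move=> i j tij; case: (tP i) => _; apply; exists j.
Qed.

(** * Diagonalising over the pruned twins *)

Unset Implicit Arguments.

Theorem theorem4 (T S : graph) (hT : is_tree T)
  (Tcount : [set: T] #= [set: nat])
  (hS : is_tree S) (ST : twins S T)
  (hcomb : exists psi : S -> T, embedding psi /\
     exists K : set (delete (range psi)),
       is_component K /\ contains_comb (induced K)) :
  infinite_twin_number T.
Proof.
have [psi [psi_emb [K [_ [C [Ccomb [h [hinj hedge]]]]]]]] := hcomb.
have [_ [phi phi_emb]] := ST.
have [rC [tC [A [[rCi rCe] Ainf eA tCoff]]]] := comb_teeth Ccomb.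
pose j (c : C) : T := val (val (h c)).
have ji : injective j by move=> c d /val_inj/val_inj/hinj.
have je c d : edge c d -> edge (j c) (j d) by move=> /hedge.
have rray : is_ray (j \o rC).
  by split=> [m n /ji /rCi //|n]; apply/je/rCe.
have [|k kP] := range_off_branch hS hT psi_emb rray.
  by move=> s n sE; apply: (set_mem (valP (val (h (rC n))))); exists s.
pose r n := j (rC (k + n)); pose t n := j (tC (k + n.+1)).
have {}rray : is_ray r.
  split=> [m n /rray.1 /addnI //|n]; rewrite /r addnS; exact: rray.2.
have toff m n : t m <> r n by move=> /ji; exact: tCoff.
pose A' := [set n | A (k + n.+1)].
have eA' n : A' n -> edge (r n.+1) (t n) by move=> /eA /je.
have A'inf : infinite_set A'.
  apply: contra_not Ainf => A'fin.
  (* The renumbering loses only the indices up to [k]. *)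
  have : finite_set (`I_k.+1 `|` (fun n => k + n.+1) @` A').
    by rewrite finite_setU; split; [exact: finite_II|exact: finite_image].
  apply: sub_finite_set => n An; have [nk|kn] := leqP n k; [by left|right].
  by exists (n - k.+1); rewrite /A' /= addnS -addSn subnKC.
have /infiniteP /pcard_leP [e] := A'inf.
have /card_eqPle [/pcard_injP [g gi] _] := Tcount.
pose T_ D := induced (pruned r t D).
have T_tree D : D `<=` A' -> is_tree (T_ D).
  by move=> DA; apply: pruned_is_tree => // n /DA /eA'.
have T_twins D : twins (T_ D) T.
  split; first by exists val; split=> [x y /val_inj|x y].
  (* The image of [psi] avoids the branch and so survives pruning; hence [T] embeds through [S]. *)
  have psiP s : pruned r t D (psi s) by left; left; exact: kP.
  exists (fun x => exist _ (psi (phi x)) (mem_set (psiP (phi x)))); split.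
    by move=> x y /(congr1 val) /= /psi_emb.1 /phi_emb.1.
  by move=> x y exy; apply: psi_emb.2; apply: phi_emb.2.
move=> [n [f fP]].
(* Each class on the list that arises from pruning gets one representative [T_ (q i)]; [set0] is a
   dummy for the others. *)
have /choice [q qP] i : exists D0, forall D, f i = iso_class (T_ D) ->
    f i = iso_class (T_ D0).
  have [[D0 fD0]|fN] := pselect (exists D0, f i = iso_class (T_ D0)).
    by exists D0.
  by exists set0 => D fD; case: fN; exists D.
(* A key names a representative and two of its vertices, given as vertices of [T] so that the type
   of keys does not depend on [i]. *)
pose R (x : 'I_n * T * T) (D : set nat) := exists u v : T_ (q x.1.1),
  [/\ val u = x.1.2, val v = x.2 & comb_end u v D].
(* Keys are countable, so they can be coded by elements of [A']; this keeps the diagonal set inside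
   [A'], where pruning yields a tree. *)
pose c (x : 'I_n * T * T) := e (pickle (x.1.1, g x.1.2, g x.2)).
have [||D DA DR] := @cantor_diagonal _ _ c R.
- move=> [[i x] y] [[i' x'] y'] ce.
  have /(pcan_inj pickleK) [-> xx yy] := inj (in_setT _) (in_setT _) ce.
  by congr (_, _, _); apply: gi; rewrite ?in_setE.
- move=> [[i x] y] D E [u [v [/= <- <- uvD]]] [u' [v' [/= /val_inj -> /val_inj -> uvE]]].
  exact: comb_end_inj uvD uvE.
have {}DA : D `<=` A' by move=> m /DA [x _ <-]; exact: funS.
have eD m : D m -> edge (r m.+1) (t m) by move=> /DA /eA'.
have [|i fi] := fP (iso_class (T_ D)); first by exists (T_ D); split=> //; exact: T_tree.
have iso : isomorphic (T_ (q i)) (T_ D).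
  change (iso_class (T_ (q i)) (T_ D)); rewrite -(qP i D fi) fi.
  exact: isomorphic_refl.
have [u [v uvD]] := pruned_comb_end hT rray toff eD.
have [u' [v' uvD']] := isomorphic_comb_end iso uvD.
(* The comb end carried over to [T_ (q i)] gives [D] a key, which the diagonal set cannot have. *)
by apply: (DR (i, val u', val v')); exists u', v'.
Qed.
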